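(* Let $k$ be a field. A finite dimensional $k$-algebra is right dual Kasch if and only if it is left Kasch.
   Context: Algebras are associative, unital and non-trivial. A ring $R$ is right dual Kasch if every simple right $R$-module is isomorphic to a factor module of an injective right $R$-module. A ring $R$ is left Kasch if every simple left $R$-module embeds into $R$ (as a left $R$-module). *)

(* Defs.v *)
From HB Require Import structures.
From mathcomp Require Import all_boot all_algebra all_field.

Set Implicit Arguments.
Unset Strict Implicit.
Unset Printing Implicit Defensive.

Import GRing.Theory.
Local Open Scope ring_scope.
Local Open Scope quotient_scope.

(* Left R-modules are [lmodType R]; right R-modules are left modules over the *)
(* converse ring, [lmodType R^c]: since b * a in R^c is a * b in R, the       *)
(* axiom scalerA reads (v.a).b = v.(a * b) when v.a denotes a *: v.           *)
(* Submodules are MathComp's [submodClosed M], that is, boolean predicates.   *)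

Section FactorModule.
Variables (R : nzRingType) (M : lmodType R) (N : submodClosed M).

Fact submod_oppr_closed : oppr_closed N.
Proof. by move=> x Nx; rewrite -scaleN1r rpredZ. Qed.

(* N as an additive subgroup: [submodClosed] does not inherit from            *)
(* [zmodClosed], over which the library's additive quotient is defined.       *)
Definition submod_zmod : {pred M} := fun x => x \in N.

Fact submod_zmod_closed : zmod_closed submod_zmod.
Proof.
by split=> [|x y Nx Ny]; [exact: rpred0 | exact/rpredD/submod_oppr_closed].
Qed.

HB.instance Definition _ :=
  GRing.isZmodClosed.Build M submod_zmod submod_zmod_closed.

Definition factor_module : Type := Quotient.quot submod_zmod.

HB.instance Definition _ := GRing.Zmodule.on factor_module.

Definition factor_scale (a : R) (q : factor_module) : factor_module :=
  \pi_(Quotient.quot submod_zmod) (a *: repr q).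

Lemma pi_factor_scale (a : R) (x : M) :
  factor_scale a (\pi_(Quotient.quot submod_zmod) x) =
  \pi_(Quotient.quot submod_zmod) (a *: x).
Proof.
apply/eqP; rewrite -Quotient.idealrBE -scalerBr.
have : repr (\pi_(Quotient.quot submod_zmod) x) - x \in submod_zmod.
  by rewrite Quotient.idealrBE reprK eqxx.
exact: (@rpredZ _ _ N).
Qed.

Fact factor_scaleA a b q :
  factor_scale a (factor_scale b q) = factor_scale (a * b) q.
Proof. by rewrite -[q]reprK (pi_factor_scale b) !pi_factor_scale scalerA. Qed.

Fact factor_scale1 : left_id 1 factor_scale.
Proof. by move=> q; rewrite -[q]reprK pi_factor_scale scale1r. Qed.

Fact factor_scaleDr : right_distributive factor_scale +%R.
Proof.
move=> a p q; rewrite -[p]reprK -[q]reprK -raddfD.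
by rewrite !pi_factor_scale scalerDr raddfD.
Qed.

Fact factor_scaleDl q : {morph factor_scale^~ q : a b / a + b}.
Proof.
by move=> a b; rewrite -[q]reprK !pi_factor_scale scalerDl raddfD.
Qed.

HB.instance Definition _ := GRing.Zmodule_isLmodule.Build R factor_module
  factor_scaleA factor_scale1 factor_scaleDr factor_scaleDl.

End FactorModule.

Definition module_iso (R : nzRingType) (M N : lmodType R) : Prop :=
  exists f : {linear M -> N}, bijective f.

Definition module_embeds (R : nzRingType) (M N : lmodType R) : Prop :=
  exists f : {linear M -> N}, injective f.

Definition simple_module (R : nzRingType) (M : lmodType R) : Prop :=
  (exists x : M, x != 0) /\
  forall N : submodClosed M, N =i pred1 0 \/ N =i predT.

Definition injective_module (R : nzRingType) (E : lmodType R) : Prop :=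
  forall (M N : lmodType R) (i : {linear M -> N}) (f : {linear M -> E}),
    injective i -> exists g : {linear N -> E}, forall x, g (i x) = f x.

Definition right_dual_kasch (R : nzRingType) : Prop :=
  forall S : lmodType R^c, simple_module S ->
    exists (E : lmodType R^c) (N : submodClosed E),
      injective_module E /\ module_iso S (factor_module N).

Definition left_kasch (R : nzRingType) : Prop :=
  forall S : lmodType R, simple_module S -> module_embeds S R^o.

(* Main.v *)
Require Import Defs.
From mathcomp Require Import all_boot all_algebra all_field.
From HB Require Import structures.
From mathcomp Require Import boolp classical_sets.

Set Implicit Arguments.
Unset Strict Implicit.
Unset Printing Implicit Defensive.

Import GRing.Theory.
Local Open Scope ring_scope.

(** Write D = Hom_k(-, k) for the duality between finite dimensional left and
right A-modules; simple modules are finite dimensional, and D preserves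
simplicity. The right module D(A) is injective, since maps into it are the same
thing as k-linear functionals, which extend along injections (Zorn).

If A is left Kasch and S is a simple right module, the simple left module D(S)
embeds in A; dually, S is a quotient of the injective module D(A).

Conversely let S be a simple left module and let h : E -> D(S) be a nonzero map
from an injective right module. Choose x in E with h(x) != 0. The submodule xA
is finite dimensional, so it embeds in Hom_k(A, xA), which is D(A)^d for
d = dim xA. As E is injective, the inclusion of xA in E extends to a map
D(A)^d -> E, whose composite with h is nonzero. Some summand D(A) therefore
has a nonzero map to D(S), and dualizing again gives a nonzero, hence
injective, map S -> A.

Duality is carried out on matrices: a finite dimensional left module is a matrix
representation [rho] acting on column vectors ([cyclic_rep]), its dual is the
transposed representation ([tr_rep], [trc_rep], [irreducible_tr]), module maps
are intertwining matrices ([rep_hom_mx]), and dualizing a map is transposing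
its matrix. D(A)^d is the transposed regular representation acting on matrices
with d columns; [cofree_injective] and [cofree_lift] are its injectivity and
universal property. *)

(** * Modules over a ring *)

Definition linear_of (R : nzRingType) (U V : lmodType R) (f : U -> V)
    (lin_f : linear f) : {linear U -> V} :=
  HB.pack f (GRing.isLinear.Build R U V *:%R f lin_f).

Definition submod_of (R : nzRingType) (V : lmodType R) (P : {pred V})
    (closedP : submod_closed P) : submodClosed V :=
  HB.pack P (GRing.isSubmodClosed.Build R V P closedP).

(** A subspace [C] maximal among those meeting the image of [i] trivially is a
complement of that image, by Zorn; the extension is [f] composed with the
projection along [C]. *)
Lemma vector_space_injective (F : fieldType) (E : lmodType F) :
  injective_module E.
Proof.
move=> M N i f inj_i.
pose P (C : set N) := (forall a x y, C x -> C y -> C (a *: x + y)) /\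
  (forall m, C (i m) -> m = 0).
have [D DP totD|C [[C_lin C_i] maxC]] := @Zorn_bigcup _ P.
  split=> [a x y [X DX Xx] [Y DY Yy]|m [X DX Xim]]; last exact: (DP X DX).2 Xim.
  by have [XY|YX] := totD X Y DX DY;
    [exists Y => //; apply: (DP Y DY).1 => //; apply: XY|
     exists X => //; apply: (DP X DX).1 => //; apply: YX].
(* The empty set is admissible in [P], so 0 must be put in [C] by maximality. *)
have C0 : C 0.
  apply: contrapT => nC0.
  have C_empty x : ~ C x.
    move=> Cx; apply: nC0; have := C_lin (-1) x x Cx Cx.
    by rewrite scaleN1r addNr.
  apply: (maxC [set 0]%classic).
    by split=> [x /C_empty //|sub]; apply: nC0; apply: sub.
  split=> [a x y -> ->|m /=]; first by rewrite /= scaler0 addr0.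
  by rewrite -(raddf0 i) => /inj_i.
have C_scale a x : C x -> C (a *: x).
  by move=> Cx; rewrite -[_ *: _]addr0; apply: C_lin.
(* Otherwise [C] could be enlarged to the span of [C] and [y]. *)
have decomp y : exists m, C (y - i m).
  apply: contrapT => /forallNP no_m.
  apply: (maxC [set z | exists a c, C c /\ z = a *: y + c]%classic).
    split=> [c Cc|sub]; first by exists 0, c; rewrite scale0r add0r.
    apply: (no_m 0); rewrite raddf0 subr0; apply: sub.
    by exists 1, 0; rewrite scale1r addr0.
  split=> [a _ _ [b [c [Cc ->]]] [b' [c' [Cc' ->]]]|m [a [c [Cc im_eq]]]].
    exists (a * b + b'), (a *: c + c'); split; first exact: C_lin.
    by rewrite scalerDr scalerDl scalerA addrACA.
  have [a0|a_neq0] := eqVneq a 0.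
    by apply: C_i; rewrite im_eq a0 scale0r add0r.
  case: (no_m (a^-1 *: m)).
  rewrite linearZ /= im_eq scalerDr scalerA mulVf // scale1r opprD addrA subrr.
  by rewrite add0r -scaleNr; apply: C_scale.
have [p pP] := choice decomp.
have p_uniq y m : C (y - i m) -> p y = m.
  move=> Cm; apply/eqP; rewrite -subr_eq0; apply/eqP/C_i.
  have := C_lin (-1) _ _ (pP y) Cm; rewrite scaleN1r opprB addrA subrK.
  by rewrite raddfB.
have p_lin : linear p.
  move=> a x y; apply: p_uniq; rewrite linearD linearZ /=.
  by rewrite opprD addrACA -scalerBr; apply: C_lin.
exists (linear_of (f := f \o p) (fun a x y => etrans (congr1 f (p_lin a x y))
  (linearP f a (p x) (p y)))) => m /=.
by congr (f _); apply: p_uniq; rewrite subrr.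
Qed.

Section SimpleModules.
Variable R : nzRingType.

Fact ker_submod_closed (M N : lmodType R) (f : {linear M -> N}) :
  submod_closed [pred z | f z == 0].
Proof.
split=> [|a y z]; rewrite !inE ?raddf0 // => /eqP fy0 /eqP fz0.
by rewrite linearP fy0 fz0 scaler0 addr0.
Qed.

Lemma simple_hom_inj (S M : lmodType R) (f : {linear S -> M}) :
  simple_module S -> (exists x, f x != 0) -> injective f.
Proof.
move=> [_ simpleS] [x fx_neq0].
have [ker0|kerT] := simpleS (submod_of (ker_submod_closed f)).
  apply: raddf_inj => y fy0.
  by have := ker0 y; rewrite !inE fy0 eqxx => /esym/eqP.
by have := kerT x; rewrite !inE (negPf fx_neq0).
Qed.

Lemma simple_hom_surj (M S : lmodType R) (f : {linear M -> S}) :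
  simple_module S -> (exists x, f x != 0) -> forall y, exists x, f x = y.
Proof.
move=> [_ simpleS] [x fx_neq0] y.
have im_closed : submod_closed [pred z | `[< exists x, f x = z >]].
  split=> [|a _ _ /asboolP[u <-] /asboolP[v <-]]; apply/asboolP.
    by exists 0; rewrite raddf0.
  by exists (a *: u + v); rewrite linearP.
have [im0|imT] := simpleS (submod_of im_closed).
  have := im0 (f x); rewrite !inE (negPf fx_neq0) => /asboolP[].
  by exists x.
by have := imT y; rewrite !inE => /asboolP.
Qed.

Definition orbit_map (M : lmodType R) (x : M) : {linear R^o -> M} :=
  linear_of (f := fun a : R^o => (a : R) *: x) (fun a b c =>
    etrans (scalerDl x (a * b) c)
      (congr1 (+%R^~ (c *: x)) (esym (scalerA a b x)))).

Lemma simple_generated (S : lmodType R) (x : S) :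
  simple_module S -> x != 0 -> forall y, exists a, y = a *: x.
Proof.
move=> simpleS x_neq0 y.
have [|a <-] := simple_hom_surj (f := orbit_map x) simpleS _ y; last first.
  by exists a.
by exists 1; rewrite /= scale1r.
Qed.

(** The canonical projection, typed so that it lands in the R-module
[factor_module N] rather than in the underlying additive quotient. *)
Definition factor_pi (M : lmodType R) (N : submodClosed M) :
    M -> factor_module N :=
  \pi_(Quotient.quot (submod_zmod N))%qT.

Lemma factor_pi_linear (M : lmodType R) (N : submodClosed M) :
  linear (@factor_pi M N).
Proof. by move=> a x y; rewrite /factor_pi raddfD /= -pi_factor_scale. Qed.

Lemma factor_pi_eq (M : lmodType R) (N : submodClosed M) x y :
  (factor_pi N x == factor_pi N y) = (x - y \in N).
Proof. by rewrite -Quotient.idealrBE. Qed.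

Lemma factor_reprK (M : lmodType R) (N : submodClosed M) :
  cancel (fun q : factor_module N => repr q : M) (@factor_pi M N).
Proof. exact: reprK. Qed.

Lemma module_iso_factor (M S : lmodType R) (f : {linear M -> S}) :
  (forall y, exists x, f x = y) ->
  exists N : submodClosed M, module_iso S (factor_module N).
Proof.
move=> /choice[g fg].
pose N := submod_of (ker_submod_closed f).
have pi_f x y : (factor_pi N x == factor_pi N y) = (f x == f y).
  by rewrite factor_pi_eq !inE raddfB subr_eq0.
have lin_g : linear (factor_pi N \o g).
  move=> a x y; rewrite /= -factor_pi_linear; apply/eqP.
  by rewrite pi_f linearP !fg.
exists N, (linear_of lin_g), (fun q => f (repr q)) => [y|q] /=.
  by rewrite -[RHS]fg; apply/eqP; rewrite -pi_f factor_reprK.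
by rewrite -[RHS]factor_reprK; apply/eqP; rewrite pi_f fg.
Qed.

End SimpleModules.

(** * Right modules as modules over the converse algebra *)

(** With the converse of a finite dimensional algebra again such an algebra,
whatever is proved for left A-modules applies to right A-modules. *)
Section ConverseAlgebra.
Variables (k : fieldType) (A : falgType k).

HB.instance Definition _ := Vector.on A^c.

Fact converse_scalerAl (c : k) (a b : A^c) :
  c *: (a * b : A^c) = (c *: a : A^c) * b.
Proof. exact: (@scalerAr k A c b a). Qed.

HB.instance Definition _ :=
  GRing.LSemiModule_isLSemiAlgebra.Build k A^c converse_scalerAl.

Fact converse_scalerAr (c : k) (a b : A^c) :
  c *: (a * b : A^c) = a * (c *: b : A^c).
Proof. exact: (@scalerAl k A c b a). Qed.

HB.instance Definition _ :=
  GRing.LSemiAlgebra_isSemiAlgebra.Build k A^c converse_scalerAr.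

End ConverseAlgebra.

Section RestrictScalars.
Variables (k : fieldType) (A : falgType k) (M : lmodType A).

Definition restrict_scalars : Type := M.

HB.instance Definition _ := GRing.Zmodule.on restrict_scalars.

Definition restricted_scale (c : k) (x : restrict_scalars) : restrict_scalars :=
  (c%:A : A) *: (x : M).

Fact restricted_scaleA a b x :
  restricted_scale a (restricted_scale b x) = restricted_scale (a * b) x.
Proof. by rewrite /restricted_scale scalerA -scalerAl mul1r scalerA. Qed.

Fact restricted_scale1 : left_id 1 restricted_scale.
Proof. by move=> x; rewrite /restricted_scale !scale1r. Qed.

Fact restricted_scaleDr : right_distributive restricted_scale +%R.
Proof. by move=> a x y; rewrite /restricted_scale [LHS]scalerDr. Qed.

Fact restricted_scaleDl x : {morph restricted_scale^~ x : a b / a + b}.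
Proof. by move=> a b; rewrite /restricted_scale !scalerDl. Qed.

HB.instance Definition _ := GRing.Zmodule_isLmodule.Build k restrict_scalars
  restricted_scaleA restricted_scale1 restricted_scaleDr restricted_scaleDl.

End RestrictScalars.

Lemma restricted_scaleE (k : fieldType) (A : falgType k) (M : lmodType A)
  (c : k) (x : restrict_scalars M) : c *: x = (c%:A : A) *: (x : M).
Proof. by []. Qed.

Definition restrict_linear (k : fieldType) (A : falgType k) (M N : lmodType A)
    (f : {linear M -> N}) : {linear restrict_scalars M -> restrict_scalars N} :=
  linear_of (f := f : restrict_scalars M -> restrict_scalars N)
    (fun c x y => linearP f c%:A x y).

(** * Matrix representations *)

Definition rep_of (k : fieldType) (A : falgType k) n (rho : A -> 'M[k]_n)
    (lin_rho : linear rho)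
    (mon_rho : monoid_morphism (rho : A -> 'M[k]_n)) :
    {lrmorphism A -> 'M[k]_n} :=
  HB.pack rho (GRing.isLinear.Build k A 'M[k]_n *:%R rho lin_rho)
   (GRing.isMonoidMorphism.Build A 'M[k]_n rho mon_rho).

Section RepModule.
Variables (k : fieldType) (A : falgType k) (n : nat).
Variables (rho : {lrmorphism A -> 'M[k]_n}) (d : nat).

Lemma rep1 : rho 1 = 1%:M. Proof. exact: rmorph1. Qed.

Lemma repM a b : rho (a * b) = rho a *m rho b. Proof. exact: rmorphM. Qed.

(** Matrices with [d] columns are the [d]-fold direct sum of the module of
column vectors; the powers D(A)^d are obtained in this way. *)
Definition rep_module of {lrmorphism A -> 'M[k]_n} : Type := 'M[k]_(n, d).

HB.instance Definition _ := GRing.Zmodule.on (rep_module rho).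

Definition rep_scale (a : A) (X : rep_module rho) : rep_module rho :=
  rho a *m (X : 'M_(n, d)).

Fact rep_scaleA a b X : rep_scale a (rep_scale b X) = rep_scale (a * b) X.
Proof. by rewrite /rep_scale repM mulmxA. Qed.

Fact rep_scale1 : left_id 1 rep_scale.
Proof. by move=> X; rewrite /rep_scale rep1 mul1mx. Qed.

Fact rep_scaleDr : right_distributive rep_scale +%R.
Proof. by move=> a X Y; rewrite /rep_scale [LHS]mulmxDr. Qed.

Fact rep_scaleDl X : {morph rep_scale^~ X : a b / a + b}.
Proof. by move=> a b; rewrite /rep_scale raddfD /= mulmxDl. Qed.

HB.instance Definition _ := GRing.Zmodule_isLmodule.Build A (rep_module rho)
  rep_scaleA rep_scale1 rep_scaleDr rep_scaleDl.

Lemma rep_scaleE (a : A) (X : rep_module rho) :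
  a *: X = rho a *m (X : 'M_(n, d)).
Proof. by []. Qed.

Lemma rep_scale_field (c : k) (X : rep_module rho) :
  (c%:A : A) *: X = c *: (X : 'M_(n, d)).
Proof. by rewrite rep_scaleE linearZ /= rep1 -scalemxAl mul1mx. Qed.

End RepModule.

Lemma mulmx_ext (R : pzSemiRingType) m n (P Q : 'M[R]_(m, n)) :
  (forall v : 'cV_n, P *m v = Q *m v) -> P = Q.
Proof.
move=> PQ; apply/matrixP=> i j; have := PQ (delta_mx j 0).
by rewrite -!colE => /colP/(_ i); rewrite !mxE.
Qed.

Section CyclicModules.
Variables (k : fieldType) (A : falgType k) (V : lmodType A) (x : V).

Let V' : lmodType k := restrict_scalars V.

Let comb n (w : 'I_n -> V') (c : 'cV[k]_n) : V' := \sum_i c i 0 *: w i.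

Let comb_linear n (w : 'I_n -> V') : linear (comb w).
Proof.
move=> a c c'; rewrite /comb scaler_sumr -big_split; apply: eq_bigr => i _.
by rewrite !mxE scalerDl scalerA.
Qed.

Let spans_orbit n (w : 'I_n -> V') :=
  (forall i, exists a : A, w i = a *: x) /\
  (forall a : A, exists c, a *: x = comb w c).

(** A finite family spanning the orbit [A x] of minimal length is free. *)
Let orbit_basis : exists n (w : 'I_n -> V'),
  spans_orbit w /\ forall c, comb w c = 0 -> c = 0.
Proof.
have ex_n : exists n, `[< exists w : 'I_n -> V', spans_orbit w >].
  pose e := vbasis {:A}.
  exists (\dim {:A}); apply/asboolP; exists (fun i => e`_i *: x : V').
  split=> [i|a]; first by exists e`_i.
  exists (\col_i coord e i a).
  rewrite {1}(coord_vbasis (memvf a)) scaler_suml; apply: eq_bigr => i _.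
  by rewrite mxE restricted_scaleE scalerA mulr_algl.
case: (ex_minnP ex_n) => n /asboolP[w [w_orb w_span]] n_min.
exists n, w; split=> // c c0; apply/colP=> j; rewrite mxE; apply/eqP.
apply: contraT => cj_neq0.
case: n => [|n] in w c j w_orb w_span n_min c0 cj_neq0 *.
  by case: j cj_neq0.
suff /n_min : `[< exists w : 'I_n -> V', spans_orbit w >] by rewrite ltnn.
apply/asboolP; exists (w \o lift j); split=> [i|a]; first exact: w_orb.
have [b ->] := w_span a.
(* Subtract the multiple of the relation [c] that kills coordinate [j]. *)
pose b' := - (b j 0 / c j 0) *: c + b.
exists (\col_i b' (lift j i) 0).
have -> : comb w b = comb w b' by rewrite comb_linear c0 scaler0 add0r.
rewrite /comb (bigD1_ord j) //= {1}/b' !mxE mulNr divfK // addNr scale0r add0r.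
by apply: eq_bigr => i _; rewrite mxE.
Qed.

(** The submodule [A x] is finite dimensional over k, so a k-basis identifies it
with column vectors on which [A] acts by matrices. For the regular module and
[x = 1] this is the regular representation. *)
Lemma cyclic_rep : exists n (rho : {lrmorphism A -> 'M[k]_n})
    (f : {linear rep_module 1 rho -> V}),
  injective f /\ exists y, f y = x.
Proof.
have [n [w [[w_orb w_span] w_free]]] := orbit_basis.
pose F : {linear 'cV[k]_n -> V'} := linear_of (comb_linear w).
have F_inj : injective F by apply: raddf_inj => c; apply: w_free.
have /choice[T T_F] : forall p : A * 'I_n, exists c, p.1 *: (w p.2 : V) = F c.
  move=> [a j] /=; have [b ->] := w_orb j; rewrite scalerA; exact: w_span.
pose rho a : 'M[k]_n := \matrix_(i, j) T (a, j) i 0.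
(* Column [j] of [rho a] holds the coordinates of [a *: w j]. *)
have F_rho a c : F (rho a *m c) = a *: (F c : V).
  have -> : rho a *m c = \sum_j c j 0 *: T (a, j).
    apply/colP=> i; rewrite mxE summxE; apply: eq_bigr => j _.
    by rewrite !mxE mulrC.
  rewrite linear_sum scaler_sumr; apply: eq_bigr => j _.
  rewrite linearZ -[F (T (a, j))](T_F (a, j)) [LHS]restricted_scaleE.
  rewrite restricted_scaleE !scalerA /=.
  by rewrite mulr_algl mulr_algr.
have lin_rho : linear rho.
  move=> a b b'; apply: mulmx_ext => c; apply: F_inj.
  rewrite mulmxDl -scalemxAl F_rho scalerDl -mulr_algl -scalerA -!F_rho.
  by rewrite [F (rho a%:A *m _)]F_rho; apply/esym/linearP.
have mon_rho : monoid_morphism rho.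
  split=> [|a b]; apply: mulmx_ext => c; apply: F_inj.
    by rewrite F_rho scale1r mul1mx.
  by rewrite -mulmxA !F_rho scalerA.
pose r := rep_of lin_rho mon_rho.
have lin_F : linear (F : rep_module 1 r -> V).
  by move=> a c c'; rewrite -F_rho; apply: raddfD.
exists n, r, (linear_of lin_F); split; first exact: F_inj.
by have [c c1] := w_span 1; exists c; rewrite scale1r in c1.
Qed.

End CyclicModules.

(** Stated for bare matrix-valued functions, so that it does not depend on which
of the two multiplications, that of A or of its converse, is respected. *)
Definition irreducible_rep (k : fieldType) (A : Type) n (rho : A -> 'M[k]_n) :=
  (exists v : 'cV[k]_n, v != 0) /\
  forall v : 'cV[k]_n, v != 0 -> forall z, exists a, rho a *m v = z.

(** Let [w != 0]. A vector [v] orthogonal to all [(rho a)^T w] has its whole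
orbit under [rho] orthogonal to [w]; were [v] nonzero, that orbit would be the
whole space and [w] would vanish. So the vectors [(rho a)^T w] have zero
annihilator, hence span the space, and by linearity of [rho] they form a
subspace. *)
Lemma irreducible_tr (k : fieldType) (A : vectType k) n
    (rho : {linear A -> 'M[k]_n}) :
  irreducible_rep rho -> irreducible_rep (fun a => (rho a)^T).
Proof.
move=> [nz irr]; split=> // w w_neq0 z.
pose e := vbasis {:A}.
pose P := \matrix_(i < n, l < \dim {:A}) ((rho e`_l)^T *m w) i 0.
have sum_P (c : 'cV_(\dim {:A})) :
    (rho (\sum_l c l 0 *: e`_l))^T *m w = P *m c.
  rewrite linear_sum raddf_sum mulmx_suml; apply/colP=> i.
  rewrite summxE [RHS]mxE; apply: eq_bigr => l _.
  by rewrite linearZ /= linearZ /= -scalemxAl !mxE mulrC.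
have free_P : row_free P.
  apply: inj_row_free => v vP0; apply/eqP; apply: contraT => v_neq0.
  have vT_neq0 : v^T != 0 by rewrite trmx_eq0.
  case/eqP: w_neq0; apply/colP=> j.
  have [a rho_a] := irr _ vT_neq0 (delta_mx j 0).
  have : v *m ((rho a)^T *m w) = 0.
    pose c : 'cV_(\dim {:A}) := \col_l coord e l a.
    have -> : a = \sum_l c l 0 *: e`_l.
      rewrite {1}(coord_vbasis (memvf a)); apply: eq_bigr => l _.
      by rewrite mxE.
    by rewrite sum_P mulmxA vP0 mul0mx.
  rewrite mulmxA -[v]trmxK -trmx_mul rho_a trmx_delta -rowE.
  by move/matrixP/(_ 0 0); rewrite !mxE.
exists (\sum_l (pinvmx P *m z) l 0 *: e`_l).
by rewrite sum_P mulmxA mulmxVp // mul1mx.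
Qed.

Section SimpleRep.
Variables (k : fieldType) (A : falgType k).

Lemma simple_irreducible_rep (V : lmodType A) : simple_module V ->
  exists n (rho : {lrmorphism A -> 'M[k]_n})
    (f : {linear rep_module 1 rho -> V}),
    bijective f /\ irreducible_rep rho.
Proof.
move=> simpleV; have [[x x_neq0] _] := simpleV.
have [n [rho [f [f_inj [m fm]]]]] := cyclic_rep x.
have /choice[g fK] : forall y, exists v, f v = y.
  move=> y; have [a ->] := simple_generated simpleV x_neq0 y.
  by exists (a *: m); rewrite linearZ /= fm.
exists n, rho, f; split; first by exists g => // v; apply: f_inj.
split=> [|v v_neq0 z].
  by exists m; apply: contraNneq x_neq0 => m0; rewrite -fm m0 raddf0.
have fv_neq0 : f v != 0.
  by apply: contraNneq v_neq0 => fv0; apply/eqP/f_inj; rewrite raddf0.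
have [a fz] := simple_generated simpleV fv_neq0 (f z).
by exists a; apply: f_inj; rewrite fz -linearZ.
Qed.

Lemma irreducible_simple n (rho : {lrmorphism A -> 'M[k]_n}) :
  irreducible_rep rho -> simple_module (rep_module 1 rho).
Proof.
move=> [nz irr]; split=> // N.
have [[v [Nv v_neq0]]|no_v] := pselect (exists v, v \in N /\ v != 0).
  right=> z; have [a <-] := irr v v_neq0 z.
  by rewrite [RHS]inE; apply: (@rpredZ _ _ N).
left=> v; rewrite [RHS]inE.
have [->|v_neq0] := eqVneq v 0; first exact: (@rpred0 _ N).
by apply/negP=> Nv; apply: no_v; exists v.
Qed.

Section RepHom.
Variables (n m : nat).
Variables (rho : {lrmorphism A -> 'M[k]_n}) (sigma : {lrmorphism A -> 'M[k]_m}).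

Definition intertwines (P : 'M[k]_(m, n)) :=
  forall a, P *m rho a = sigma a *m P.

Fact rep_hom_linear d (P : 'M[k]_(m, n)) : intertwines P ->
  linear (fun v : rep_module d rho =>
    P *m (v : 'M_(n, d)) : rep_module d sigma).
Proof.
by move=> P_hom a v w; rewrite [LHS]mulmxDr !rep_scaleE mulmxA P_hom mulmxA.
Qed.

Definition rep_hom d (P : 'M[k]_(m, n)) (P_hom : intertwines P) :
  {linear rep_module d rho -> rep_module d sigma} :=
  linear_of (rep_hom_linear (d := d) P_hom).

(** Maps of A-modules are k-linear, hence given by matrices. *)
Lemma rep_hom_mx (f : {linear rep_module 1 rho -> rep_module 1 sigma}) :
  exists2 P, intertwines P & forall v : 'cV_n, f v = P *m v.
Proof.
have lin_f : linear (f : 'cV[k]_n -> 'cV[k]_m).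
  move=> c v w; rewrite -(rep_scale_field (rho := rho)) [LHS]linearP.
  by rewrite rep_scale_field.
pose g : {linear 'cV[k]_n -> 'cV[k]_m} := linear_of lin_f.
pose P : 'M[k]_(m, n) := \matrix_(i, j) g (delta_mx j 0) i 0.
have fP v : f v = P *m v.
  rewrite -[LHS]/(g v) {1}[v]matrix_sum_delta linear_sum; apply/colP=> i.
  rewrite summxE mxE; apply: eq_bigr => j _.
  by rewrite big_ord1 linearZ !mxE mulrC.
exists P => // a; apply: mulmx_ext => v.
by rewrite -!mulmxA -!fP; apply: (linearZ_LR f).
Qed.

End RepHom.
End SimpleRep.

(** * Duality of representations *)

Section TransposeRep.
Variables (k : fieldType) (A : falgType k) (n : nat).

Fact tr_rep_linear (V : lmodType k) (rho : {linear V -> 'M[k]_n}) :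
  linear (fun a => (rho a)^T).
Proof. by move=> c a b; rewrite linearP linearP. Qed.

Fact tr_rep_monoid (rho : {lrmorphism A -> 'M[k]_n}) :
  monoid_morphism (fun a : A^c => (rho a)^T).
Proof.
split=> [|a b]; first by rewrite (rep1 rho) trmx1.
by rewrite [rho _](repM rho b a) trmx_mul.
Qed.

Definition tr_rep (rho : {lrmorphism A -> 'M[k]_n}) :
    {lrmorphism A^c -> 'M[k]_n} :=
  rep_of (A := A^c) (tr_rep_linear rho) (tr_rep_monoid rho).

(** The converse of the converse of A is not convertible to A as a ring, so the
dual of a right module needs its own construction. *)
Fact trc_rep_monoid (sigma : {lrmorphism A^c -> 'M[k]_n}) :
  monoid_morphism (fun a : A => (sigma a)^T).
Proof.
split=> [|a b]; first by rewrite (rep1 sigma) trmx1.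
by rewrite [sigma _](repM sigma b a) trmx_mul.
Qed.

Definition trc_rep (sigma : {lrmorphism A^c -> 'M[k]_n}) :
    {lrmorphism A -> 'M[k]_n} :=
  rep_of (A := A) (tr_rep_linear sigma) (trc_rep_monoid sigma).

End TransposeRep.

(** * The injective modules D(A)^d *)

(** Here [phi] identifies the regular representation [reg] with the left module
A, and [u] are the coordinates of 1. An element [X] of [D] stands for the
k-linear map sending the element of A with coordinates [v] to [v^T *m X]; thus
[D] is Hom_k(A, k^d), and [u^T *m X] is evaluation at 1. *)
Section CofreeModule.
Variables (k : fieldType) (A : falgType k) (n : nat).
Variables (reg : {lrmorphism A -> 'M[k]_n}).
Variables (phi : {linear rep_module 1 reg -> A^o}) (phi_inj : injective phi).
Variables (u : 'cV[k]_n) (phi_u : phi u = 1).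
Variable d : nat.

Let D : lmodType A^c := rep_module d (tr_rep reg).

Let phi_scale (a : A) (v : 'cV[k]_n) : phi (reg a *m v) = a * (phi v : A).
Proof. exact: (linearZ_LR phi). Qed.

(** A k-linear map [psi : N -> k^d] gives the A-linear map sending [y] to the
function [a |-> psi (y a)] in Hom_k(A, k^d), recorded here by its values on the
basis of A. *)
Lemma cofree_lift (N : lmodType A^c)
    (psi : {linear restrict_scalars N -> 'rV[k]_d}) :
  exists g : {linear N -> D}, forall y, u^T *m (g y : 'M_(n, d)) = psi y.
Proof.
pose g y : 'M[k]_(n, d) :=
  \matrix_(j, l) psi ((phi (delta_mx j 0) : A^c) *: (y : N)) 0 l.
have lin_phi : linear (phi : 'cV[k]_n -> A).
  move=> c v w; rewrite -(rep_scale_field (rho := reg)) [LHS]linearP.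
  by congr (_ + _); apply: mulr_algl.
have gE (v : 'cV_n) y : v^T *m g y = psi ((phi v : A^c) *: (y : N)).
  have lin_psi : linear (fun v : 'cV[k]_n =>
      psi ((phi v : A^c) *: (y : N) : restrict_scalars N)).
    move=> c w w'; rewrite -[RHS](linearP psi); congr (psi _).
    rewrite [phi _]lin_phi [LHS]scalerDl; congr (_ + _).
    by rewrite restricted_scaleE scalerA mulr_algl.
  rewrite {2}[v]matrix_sum_delta [RHS](linear_sum (linear_of lin_psi)).
  apply/rowP=> l; rewrite mxE summxE; apply: eq_bigr => j _.
  by rewrite big_ord1 [in RHS](linearZ_LR (linear_of lin_psi)) !mxE.
have lin_g : linear (g : N -> D).
  move=> b y y'; apply/(can_inj (@trmxK _ _ _))/mulmx_ext => v; apply: trmx_inj.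
  rewrite !trmx_mul !trmxK gE mulmxDr [X in _ = X + _]mulmxA -trmx_mul.
  rewrite !gE scalerDr -[RHS](linearD psi) phi_scale.
  by congr (psi (_ + _)); rewrite scalerA.
exists (linear_of lin_g) => y.
by rewrite [LHS]gE phi_u scale1r.
Qed.

(** A function in Hom_k(A, k^d) takes at [a] the value that its translate by [a]
takes at 1, so an A-linear map is determined by evaluation at 1. *)
Lemma cofree_hom_ext (N : lmodType A^c) (g h : {linear N -> D}) :
  (forall y, u^T *m (g y : 'M_(n, d)) = u^T *m (h y : 'M_(n, d))) -> g =1 h.
Proof.
move=> gh y; apply/row_matrixP => j; rewrite !rowE -trmx_delta.
set e := delta_mx j 0.
have -> : e = reg (phi e) *m u.
  by apply: phi_inj; rewrite phi_scale phi_u mulr1.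
rewrite trmx_mul -!mulmxA.
by have := gh ((phi e : A^c) *: y); rewrite !linearZ_LR.
Qed.

(** Maps into D(A)^d are k-linear maps into k^d, and these extend because k^d is
an injective k-module. *)
Lemma cofree_injective : injective_module D.
Proof.
move=> M N i f inj_i.
have lin_ev : linear (fun v : restrict_scalars D => u^T *m (v : 'M[k]_(n, d))).
  move=> c v w; rewrite mulmxDr restricted_scaleE; congr (_ + _).
  by rewrite rep_scale_field scalemxAr.
pose ev : {linear restrict_scalars D -> 'rV[k]_d} := linear_of lin_ev.
have [psi psi_i] := @vector_space_injective k 'rV[k]_d _ _ (restrict_linear i)
  (ev \o restrict_linear f) inj_i.
have [g gE] := cofree_lift psi.
exists g; apply: (cofree_hom_ext (g := g \o i)) => y /=.
by rewrite gE psi_i.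
Qed.

End CofreeModule.

(** * The equivalence *)

Lemma linear_inverse (R : nzRingType) (M N : lmodType R) (f : {linear M -> N}) :
  bijective f -> exists g : {linear N -> M}, cancel f g /\ cancel g f.
Proof.
move=> [g fK gK].
have lin_g : linear g by move=> a x y; apply: (canLR fK); rewrite linearP !gK.
by exists (linear_of lin_g).
Qed.

Lemma factor_iso_hom (R : nzRingType) (M S : lmodType R) (N : submodClosed M) :
  module_iso S (factor_module N) ->
  exists h : {linear M -> S}, forall y, exists x, h x = y.
Proof.
move=> [q /linear_inverse[q' [qK q'K]]].
exists (q' \o linear_of (@factor_pi_linear _ M N)) => y.
by exists (repr (q y)); rewrite /= factor_reprK qK.
Qed.

Lemma mulmx_neq0 (R : pzSemiRingType) m n (P : 'M[R]_(m, n)) :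
  P != 0 -> exists v : 'cV_n, P *m v != 0.
Proof.
move=> P_neq0; apply: contrapT => /forallNP Pv0; case/eqP: P_neq0.
apply: mulmx_ext => v; rewrite mul0mx; apply/eqP.
by apply: contrapT => /negP /Pv0.
Qed.

(** A map that is nonzero on a direct sum is nonzero on a summand; the summands
here are the columns. *)
Lemma rep_module_column (k : fieldType) (A : falgType k) n
    (rho : {lrmorphism A -> 'M[k]_n}) d (M : lmodType A)
    (f : {linear rep_module d rho -> M}) :
  (exists X, f X != 0) ->
  exists g : {linear rep_module 1 rho -> M}, exists v, g v != 0.
Proof.
move=> [X fX_neq0].
have lin_incl j : linear (fun v : rep_module 1 rho =>
    (v : 'cV_n) *m delta_mx 0 j : rep_module d rho).
  by move=> a v w; rewrite [LHS]mulmxDl !rep_scaleE mulmxA.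
apply: contrapT => /forallNP no_g; case/eqP: fX_neq0.
have -> : X = \sum_j linear_of (lin_incl j) (col j X).
  rewrite {1}[X]matrix_sum_delta exchange_big; apply: eq_bigr => j _ /=.
  rewrite [col j X]matrix_sum_delta mulmx_suml; apply: eq_bigr => i _.
  by rewrite big_ord1 mxE -scalemxAl mul_delta_mx.
rewrite linear_sum big1 // => j _; apply/eqP; apply: contrapT => /negP f_neq0.
by apply: (no_g (f \o linear_of (lin_incl j))); exists (col j X).
Qed.

Theorem corollary4p2 (k : fieldType) (A : falgType k) :
  right_dual_kasch A <-> left_kasch A.
Proof.
have [n [reg [phi [phi_inj [u phi_u]]]]] := cyclic_rep (1 : A^o).
split=> [dual_kasch S simpleS | kasch S simpleS].
  have [m [rho [f [f_bij irr]]]] := simple_irreducible_rep simpleS.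
  have simple_dual : simple_module (rep_module 1 (tr_rep rho)).
    exact/irreducible_simple/irreducible_tr.
  have [E [N [injE /factor_iso_hom[h h_surj]]]] := dual_kasch _ simple_dual.
  have [[y y_neq0] _] := simple_dual; have [x hx] := h_surj y.
  have [d [tau [incl [incl_inj [x0 incl_x0]]]]] := cyclic_rep (A := A^c) x.
  have lin_tr : linear (fun v : restrict_scalars (rep_module 1 tau) =>
      (v : 'cV[k]_d)^T).
    by move=> c v w; rewrite restricted_scaleE rep_scale_field linearP.
  (* [g] embeds xA in D(A)^d; evaluation at 1 recovers the coordinates. *)
  have [g gE] := cofree_lift phi_u (linear_of lin_tr).
  have g_inj : injective g.
    by move=> v w gvw; apply/trmx_inj; rewrite -[LHS]gE gvw gE.
  have [G GE] := injE _ _ g incl g_inj.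
  have [|t [X tX_neq0]] := rep_module_column (f := h \o G).
    by exists (g x0); rewrite /= GE incl_x0 hx.
  have [P P_hom tE] := rep_hom_mx t.
  have PT_hom : intertwines rho reg P^T.
    move=> a; apply: trmx_inj; rewrite !trmx_mul trmxK; exact/esym/P_hom.
  have [|v Pv_neq0] := @mulmx_neq0 _ _ _ P^T.
    by apply: contraNneq tX_neq0 => /(canRL (@trmxK _ _ _)) P0;
       rewrite tE P0 trmx0 mul0mx.
  have [f' [fK f'K]] := linear_inverse f_bij.
  exists (phi \o rep_hom 1 PT_hom \o f').
  apply: simple_hom_inj => //; exists (f v); rewrite /= fK.
  by apply: contraNneq Pv_neq0 => e; apply/eqP/phi_inj; rewrite e raddf0.
have [m [sigma [f [f_bij irr]]]] := simple_irreducible_rep (A := A^c) simpleS.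
have simple_dual : simple_module (rep_module 1 (trc_rep sigma)).
  exact/irreducible_simple/(irreducible_tr (A := A^c)).
have [h h_inj] := kasch _ simple_dual.
have orbit_inj : injective (orbit_map (u : rep_module 1 reg)).
  apply: (can_inj (g := phi)) => a.
  by rewrite linearZ /= phi_u [LHS]mulr1.
have [P P_hom PE] := rep_hom_mx (orbit_map (u : rep_module 1 reg) \o h).
have PT_hom : intertwines (tr_rep reg) sigma P^T.
  by move=> a; apply: trmx_inj; rewrite !trmx_mul !trmxK; apply/esym/P_hom.
exists (rep_module 1 (tr_rep reg)).
have [|N isoS] := module_iso_factor (f := f \o rep_hom 1 PT_hom).
  apply: simple_hom_surj => //=.
  have [|v Pv_neq0] := @mulmx_neq0 _ _ _ P^T.
    have [[w w_neq0] _] := simple_dual.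
    apply: contraNneq w_neq0 => /(canRL (@trmxK _ _ _)) P0.
    by apply/eqP/h_inj/orbit_inj; rewrite raddf0 raddf0;
       have := PE w; rewrite P0 trmx0 mul0mx.
  exists v; apply: contraNneq Pv_neq0 => fPv0; apply/eqP.
  by apply: (bij_inj f_bij); rewrite fPv0 raddf0.
by exists N; split=> //; apply: cofree_injective phi_inj u phi_u 1.
Qed.
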